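(* If $S_1^+=S_1$ or $k=\mu_s$, then the inequality $$w\le\sum_{i\in S_1}\zeta(-a_i)(\mu_i-x_i)+\sum_{i\in S_0}\phi(a_i)x_i+\rho_s(k)(x_s-k)+g(ka_s)$$ is facet-defining for $\operatorname{conv}(\mathcal{X})$. Here $\phi:[0,\infty)\to\mathbb{R}$ is given as follows. (i) If $S_1^+=S_1$, let $S_1^+=\{j_1,\dots,j_d\}$ ($d\ge 0$) with $a_{j_1}\ge\dots\ge a_{j_d}$, $A_{i,q}=\sum_{t=1}^{i-1}\mu_{j_t}a_{j_t}+q\,a_{j_i}$ for $1\le i\le d$, $0\le q\le\mu_{j_i}$, and $A_*=\sum_{t=1}^d\mu_{j_t}a_{j_t}$. Then: - $\phi(\delta)=g(\delta+\mu_sa_s-A_{i+1,q})-\sum_{t=1}^{i}\mu_{j_t}\zeta(-a_{j_t})-q\,\zeta(-a_{j_{i+1}})+(k-\mu_s)\rho_s(k)-g(ka_s)$ if $A_{i+1,q-1}\le\delta<A_{i+1,q}+(k-\mu_s-1)a_s$, $i=0,\dots,d-1$, $q=1,\dots,\mu_{j_{i+1}}$; - $\phi(\delta)=g(\delta+(\mu_s-\ell)a_s-A_{i+1,q})-\sum_{t=1}^{i}\mu_{j_t}\zeta(-a_{j_t})-q\,\zeta(-a_{j_{i+1}})+(k-\mu_s+\ell)\rho_s(k)-g(ka_s)$ if $A_{i+1,q}+(k-\mu_s+\ell-1)a_s\le\delta<A_{i+1,q}+(k-\mu_s+\ell)a_s$, $i=0,\dots,d-1$, $q=1,\dots,\mu_{j_{i+1}}$,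 $\ell=0,\dots,\mu_s-k$; - $\phi(\delta)=g(\delta+(\mu_s-\ell)a_s-A_* )-\sum_{t=1}^{d}\mu_{j_t}\zeta(-a_{j_t})+(k-\mu_s+\ell)\rho_s(k)-g(ka_s)$ if $A_*+(k-\mu_s+\ell-1)a_s\le\delta<A_*+(k-\mu_s+\ell)a_s$, $\ell=\mu_s-k+1,\dots,\mu_s$; - $\phi(\delta)=g(\delta-A_* )-\sum_{t=1}^{d}\mu_{j_t}\zeta(-a_{j_t})+k\rho_s(k)-g(ka_s)$ if $\delta\ge A_*+ka_s$. (ii) If $k=\mu_s$, let $S_1\cup\{s\}=\{j_1,\dots,j_{d+1}\}$ ($d\ge 0$) with $a_{j_1}\ge\dots\ge a_{j_{d+1}}$ and $A_{i,q}=\sum_{t=1}^{i-1}\mu_{j_t}a_{j_t}+q\,a_{j_i}$ for $1\le i\le d+1$, $0\le q\le\mu_{j_i}$. Then: - $\phi(\delta)=g(\delta+\mu_sa_s-A_{i+1,q})-\sum_{t=1}^{i}\mu_{j_t}\zeta(-a_{j_t})-q\,\zeta(-a_{j_{i+1}})-g(\mu_sa_s)$ if $A_{i+1,q-1}\le\delta<A_{i+1,q}$, $i=0,\dots,d$, $q=1,\dots,\mu_{j_{i+1}}$; - $\phi(\delta)=g(\delta+\mu_sa_s-A_{d+1,\mu_{j_{d+1}}})-\sum_{t=1}^{d+1}\mu_{j_t}\zeta(-a_{j_t})-g(\mu_sa_s)$ if $\delta\ge A_{d+1,\mu_{j_{d+1}}}$.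
   Context: Let $n\ge 1$, let $f:\mathbb{R}\to\mathbb{R}$ be concave, let $a\in\mathbb{R}^n$ with $a_i\ge 0$ for all $i$, and let $\mu\in\mathbb{Z}^n$ with all $\mu_i\ge 1$. Define $$\mathcal{X}=\{(w,x)\in\mathbb{R}\times\mathbb{Z}^n : w\le f(a^\top x),\ 0\le x_i\le\mu_i\ \text{for } i=1,\dots,n\}.$$ Fix $s\in\{1,\dots,n\}$ with $a_s>0$, disjoint subsets $S_0,S_1$ of $\{1,\dots,n\}\setminus\{s\}$ with $\{s\}\cup S_0\cup S_1=\{1,\dots,n\}$, and an integer $k\in\{1,\dots,\mu_s\}$. Define $g(z)=f\big(z+\sum_{i\in S_1}\mu_i a_i\big)$, $\rho_s(k)=g(ka_s)-g((k-1)a_s)$, $$\zeta(\delta)=\max\big\{g(\delta+a_s x)-\rho_s(k)(x-k)-g(ka_s) : x\in\mathbb{Z},\ 0\le x\le\mu_s\big\}\quad(\delta\in\mathbb{R}),$$ and $S_1^+=\{i\in S_1 : a_i\ge(\mu_s-k+1)a_s\}$. A linear inequality is facet-defining for a polyhedron $P$ if it is valid for $P$ and the set of points of $P$ satisfying it with equality is a face of dimension $\dim P-1$. *)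

(* Defs.v *)
From HB Require Import structures.
From mathcomp Require Import all_boot all_order all_algebra.
From mathcomp Require Import boolp classical_sets reals convex.

Set Implicit Arguments.
Unset Strict Implicit.
Unset Printing Implicit Defensive.

Import Order.TTheory GRing.Theory Num.Theory.
Local Open Scope classical_set_scope.
Local Open Scope ring_scope.

Definition concave_function (R : realType) (f : R -> R) : Prop :=
  forall x y t : R, 0 <= t <= 1 ->
    t * f x + (1 - t) * f y <= f (t * x + (1 - t) * y).

Section Polyhedra.
Context {R : realType} {V : vectType R}.

Definition conv_hull (A : set V) : set V := smallest (@convex_set R V) A.

Definition affinely_independent (s : seq V) : bool :=
  if s is x :: s' then free [seq y - x | y <- s'] else true.

(* The dimension is one less than the maximal number of affinely independent
   points; in particular the empty set has dimension -1. *)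
Definition has_dim (P : set V) (d : int) : Prop :=
  (exists s : seq V, [/\ forall x, x \in s -> P x, affinely_independent s
                       & (size s)%:Z = d + 1]) /\
  (forall s : seq V, (forall x, x \in s -> P x) -> affinely_independent s ->
     (size s)%:Z <= d + 1).

Definition affine_function (h : V -> R) : Prop :=
  forall (x y : V) (t : R),
    h (t *: x + (1 - t) *: y) = t * h x + (1 - t) * h y.

(* The inequality lhs p <= rhs p.  Since both sides are affine and the
   inequality is valid, its equality set in P is a face of P. *)
Definition facet_defining (P : set V) (lhs rhs : V -> R) : Prop :=
  [/\ affine_function lhs, affine_function rhs,
      forall p, P p -> lhs p <= rhs p
    & exists d : int, has_dim P d /\
        has_dim (P `&` [set p | lhs p = rhs p]) (d - 1)].

End Polyhedra.

Section Lifting.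
Context {R : realType} {n : nat}.
Context (f : R -> R) (a : 'rV[R]_n) (mu : 'I_n -> nat).

Definition mixed_set : set (R^o * 'rV[R]_n)%type :=
  [set p : R^o * 'rV[R]_n | p.1 <= f (\sum_i a 0 i * p.2 0 i) /\
    forall i, [/\ p.2 0 i \is a Num.int, 0 <= p.2 0 i
                & p.2 0 i <= (mu i)%:R]].

Context (s : 'I_n) (S1 : {set 'I_n}) (k : nat).

Definition g (z : R) : R := f (z + \sum_(i in S1) (mu i)%:R * a 0 i).

Definition rho : R := g (k%:R * a 0 s) - g ((k%:R - 1) * a 0 s).

(* The base value of the iterated maximum is the term x = 0, which belongs to
   the range, so this is exactly the maximum over 0 <= x <= mu s. *)
Definition zeta (delta : R) : R :=
  let F (x : nat) :=
    g (delta + a 0 s * x%:R) - rho * (x%:R - k%:R) - g (k%:R * a 0 s) in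
  \big[Num.max/F 0%N]_(x < (mu s).+1) F x.

Definition S1plus : {set 'I_n} :=
  [set i in S1 | ((mu s)%:R - k%:R + 1) * a 0 s <= a 0 i]%SET.

Definition decreasing_enum (A : {set 'I_n}) (js : seq 'I_n) : Prop :=
  [/\ uniq js, js =i A & sorted (fun i j => a 0 j <= a 0 i) js].

(* With js = [:: j_1; ...; j_d], the entry j_(i+1) is [nth s js i], so [A_ js i q]
   is A_(i+1,q) = mu_(j_1) a_(j_1) + ... + mu_(j_i) a_(j_i) + q a_(j_(i+1)), and
   [A_ js (size js) 0] is A_* (the default s of nth then has coefficient 0). *)
Definition A_ (js : seq 'I_n) (i q : nat) : R :=
  \sum_(j <- take i js) (mu j)%:R * a 0 j + q%:R * a 0 (nth s js i).

Definition zeta_sum (js : seq 'I_n) (i : nat) : R :=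
  \sum_(j <- take i js) (mu j)%:R * zeta (- a 0 j).

Definition phi_spec_i (js : seq 'I_n) (phi : R -> R) : Prop :=
  let d := size js in
  let as_ := a 0 s in
  let ms := (mu s)%:R : R in
  let kR := k%:R : R in
  let Astar := A_ js d 0 in
  [/\ forall (i q : nat) (delta : R),
        (i < d)%N -> (1 <= q <= mu (nth s js i))%N ->
        A_ js i q.-1 <= delta < A_ js i q + (kR - ms - 1) * as_ ->
        phi delta = g (delta + ms * as_ - A_ js i q)
                    - zeta_sum js i - q%:R * zeta (- a 0 (nth s js i))
                    + (kR - ms) * rho - g (kR * as_),
      forall (i q l : nat) (delta : R),
        (i < d)%N -> (1 <= q <= mu (nth s js i))%N -> (l <= mu s - k)%N ->
        A_ js i q + (kR - ms + l%:R - 1) * as_ <= delta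
          < A_ js i q + (kR - ms + l%:R) * as_ ->
        phi delta = g (delta + (ms - l%:R) * as_ - A_ js i q)
                    - zeta_sum js i - q%:R * zeta (- a 0 (nth s js i))
                    + (kR - ms + l%:R) * rho - g (kR * as_),
      forall (l : nat) (delta : R),
        (mu s - k + 1 <= l <= mu s)%N ->
        Astar + (kR - ms + l%:R - 1) * as_ <= delta
          < Astar + (kR - ms + l%:R) * as_ ->
        phi delta = g (delta + (ms - l%:R) * as_ - Astar)
                    - zeta_sum js d
                    + (kR - ms + l%:R) * rho - g (kR * as_)
    & forall delta : R,
        Astar + kR * as_ <= delta ->
        phi delta = g (delta - Astar) - zeta_sum js d
                    + kR * rho - g (kR * as_)].

(* Here js enumerates S1 together with s, so d is one less than its length. *)
Definition phi_spec_ii (js : seq 'I_n) (phi : R -> R) : Prop :=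
  let d := (size js).-1 in
  let as_ := a 0 s in
  let ms := (mu s)%:R : R in
  let Alast := A_ js d (mu (nth s js d)) in
  (forall (i q : nat) (delta : R),
     (i <= d)%N -> (1 <= q <= mu (nth s js i))%N ->
     A_ js i q.-1 <= delta < A_ js i q ->
     phi delta = g (delta + ms * as_ - A_ js i q)
                 - zeta_sum js i - q%:R * zeta (- a 0 (nth s js i))
                 - g (ms * as_)) /\
  (forall delta : R,
     Alast <= delta ->
     phi delta = g (delta + ms * as_ - Alast)
                 - zeta_sum js d.+1 - g (ms * as_)).

End Lifting.

(* Main.v *)
From HB Require Import structures.
Require Import Defs.
From mathcomp Require Import all_boot all_order all_algebra.
From mathcomp Require Import boolp classical_sets reals convex.
From mathcomp Require Import unstable interval_inference lra ring zify.

Set Implicit Arguments.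
Unset Strict Implicit.
Unset Printing Implicit Defensive.

Import Order.TTheory GRing.Theory Num.Theory.
Local Open Scope ring_scope.

(* Complement the variables of [S1] and let H be g recentred at [k a_s]; H is
   concave with [H 0 = 0].  All lifting functions in the theorem are greedy
   functions: [greedy psi l] starts from [psi] and, crossing each item [a] of the
   decreasing list [l], restarts [psi] on [[- a, 0)] with the cost [psi (- a)]
   already paid.  Up to a shift, zeta is greedy over [mu_s] copies of [a_s] with
   base H, and phi is greedy over the copies of the [a_j], with base zeta in case
   (i) and base H over [S1] together with [s] in case (ii).  If [psi] is
   subadditive on negative numbers and each [t |-> psi (t - b) - psi (- b)], for
   [b] at least the smallest item, is subadditive on [t >= 0], the latter property
   passes to [greedy psi l] by induction on [l].  It makes phi subadditive, which
   gives validity, and makes the greedy choice optimal.  Tight points, one per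
   variable plus a base point, are affinely independent because they are
   triangular in the order s, S1, S0. *)

(** * Greedy lifting functions *)

Section GreedyLifting.
Context {R : realFieldType}.
Implicit Types (psi : R -> R) (l : seq R) (a b x y z beta : R).

Definition subadditive_neg psi : Prop :=
  forall x y, x <= 0 -> y <= 0 -> psi (x + y) <= psi x + psi y.

Definition subadditive_nonneg psi : Prop :=
  forall x y, 0 <= x -> 0 <= y -> psi (x + y) <= psi x + psi y.

(* Subadditivity of [t |-> psi (t - b) - psi (- b)] on [t >= 0]. *)
Definition subadditive_from psi b : Prop :=
  forall x y, 0 <= x -> 0 <= y ->
    psi (x + y - b) + psi (- b) <= psi (x - b) + psi (y - b).

Fixpoint greedy psi l z : R :=
  if l is a :: l' then
    if z < 0 then psi z else greedy psi l' (z - a) - psi (- a)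
  else psi z.

Section Properties.
Context (psi : R -> R).
Context (psi0 : psi 0 = 0).

Lemma greedy_cons_ge0 a l z :
  0 <= z -> greedy psi (a :: l) z = greedy psi l (z - a) - psi (- a).
Proof. by move=> z0 /=; rewrite ltNge z0. Qed.

Lemma greedy_le0 l z :
  all (>= 0) l -> z <= 0 -> greedy psi l z = psi z.
Proof.
elim: l z => [//|a l IH] z /= /andP[a0 l0] z0.
case: ltgtP z0 => // -> _; rewrite sub0r psi0 IH ?subrr //; lra.
Qed.

Lemma greedy0 l : all (>= 0) l -> greedy psi l 0 = 0.
Proof. by move=> l0; rewrite greedy_le0. Qed.

Lemma greedy_rcons_cat l1 a l2 z :
  all (>= 0) l1 -> \sum_(b <- l1) b <= z ->
  greedy psi (rcons l1 a ++ l2) z =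
    greedy psi l2 (z - \sum_(b <- rcons l1 a) b)
      - \sum_(b <- rcons l1 a) psi (- b).
Proof.
elim: l1 z => [|b l1 IH] z /=.
  by rewrite !big_seq1 big_nil => _ z0; rewrite ltNge z0.
move=> /andP[b0 l0]; rewrite !big_cons => lz.
have s0 : 0 <= \sum_(c <- l1) c.
  by rewrite big_seq sumr_ge0 // => c /(allP l0).
rewrite ltNge (le_trans _ lz) /=; last lra.
by rewrite IH //; [rewrite !opprD !addrA addrAC|lra].
Qed.

Context (Pneg : subadditive_neg psi).

Lemma greedy_subadditive_from beta l b :
  (forall c, beta <= c -> subadditive_from psi c) -> 0 <= beta ->
  sorted >=%R (b :: l) -> all (>= beta) (b :: l) ->
  subadditive_from (greedy psi l) b.
Proof.
move=> Pfrom beta0; elim: l b => [|a l IH] b; first by rewrite /= andbT => _; apply: Pfrom.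
move=> srt /[dup] H /and3P[bb ba bl] {H} x y x0 y0.
have /andP[ab srta] : (a <= b) && sorted >=%R (a :: l) by [].
have srtb : sorted >=%R (b :: l).
  by move: srta => /=; case: (l) => //= c l' /andP[ca ->]; rewrite (le_trans ca ab).
have l0 : all (>= 0) l by apply: sub_all bl => c; apply: le_trans.
have IHa : subadditive_from (greedy psi l) a by apply: IH; rewrite //= ba.
have IHb : subadditive_from (greedy psi l) b by apply: IH; rewrite //= bb.
have b0 : 0 <= b by apply: le_trans bb.
have a0 : 0 <= a by apply: le_trans ba.
have gb : greedy psi l (- b) = psi (- b) by rewrite greedy_le0 //; lra.
have ga : greedy psi l (- a) = psi (- a) by rewrite greedy_le0 //; lra.
have g0 := greedy0 l0.
have neg z : z < 0 -> greedy psi (a :: l) z = psi z by move=> /= ->.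
have -> : greedy psi (a :: l) (- b) = psi (- b).
  by apply: greedy_le0; rewrite /= ?a0 ?l0 //; lra.
have [xyb|xyb] := ltP (x + y) b.
  by rewrite !neg; [apply: Pfrom|lra|lra|lra].
rewrite greedy_cons_ge0; last lra.
wlog yx : x y x0 y0 xyb / y <= x.
  by move=> W; case: (leP y x) => [/W|/ltW /W]; [|rewrite [y + x]addrC [greedy _ _ (y - b) + _]addrC]; apply.
have [xb|xb] := ltP x b; last first.
  rewrite (greedy_cons_ge0 _ _ (z := x - b)); last lra.
  have [yb|yb] := ltP y b.
    rewrite neg; last lra.
    have := IHb (x - a) y ltac:(lra) y0.
    rewrite gb (greedy_le0 (z := y - b)) //; last lra.
    have -> : x - a + y - b = x + y - b - a by lra.
    have -> : x - a - b = x - b - a by lra.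
    lra.
  rewrite greedy_cons_ge0; last lra.
  have := IHa (x - b) (y - b) ltac:(lra) ltac:(lra).
  have := IHb (x + y - b - a) b ltac:(lra) b0.
  rewrite ga gb subrr g0.
  have -> : x + y - b - a + b - b = x + y - b - a by lra.
  have -> : x - b + (y - b) - a = x + y - b - a - b by lra.
  lra.
rewrite !neg; [|lra|lra].
have [ya|ya] := leP a x; last first.
  rewrite greedy_le0 //; last lra.
  have := Pfrom b bb y (b - a) y0 ltac:(lra).
  have := @Pneg (y - a) (x - b) ltac:(lra) ltac:(lra).
  have -> : y - a + (x - b) = x + y - b - a by lra.
  have -> : y + (b - a) - b = y - a by lra.
  have -> : b - a - b = - a by lra.
  lra.
have := IHb (x - a) y ltac:(lra) y0.
rewrite gb (greedy_le0 (z := y - b)) // ?(greedy_le0 (z := x - a - b)) //; [|lra|lra].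
have := @Pneg (x - b) (- a) ltac:(lra) ltac:(lra).
have -> : x - b - a = x - a - b by lra.
have -> : x - a + y - b = x + y - b - a by lra.
lra.
Qed.

Context (Pnonneg : subadditive_nonneg psi).

Lemma greedy_subadditive beta l :
  (forall c, beta <= c -> subadditive_from psi c) -> 0 <= beta ->
  sorted >=%R l -> all (>= beta) l -> subadditive_nonneg (greedy psi l).
Proof.
move=> Pfrom beta0; case: l => [|a l] srt bl x y x0 y0; first exact: Pnonneg.
rewrite !greedy_cons_ge0 ?addr_ge0 //.
have := greedy_subadditive_from Pfrom beta0 srt bl x0 y0.
rewrite (greedy_le0 (z := - a)).
- lra.
- by move: bl => /= /andP[_]; apply: sub_all => c; apply: le_trans.
- by move: bl => /= /andP[ba _]; lra.
Qed.

Lemma greedy_ge beta l t z :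
  (forall c, beta <= c -> subadditive_from psi c) -> 0 <= beta ->
  sorted >=%R l -> all (>= beta) l -> subseq t l ->
  psi (z - \sum_(b <- t) b) - \sum_(b <- t) psi (- b) <= greedy psi l z.
Proof.
move=> Pfrom beta0; elim: l t z => [|a l IH] t z srt bl.
  by rewrite subseq0 => /eqP ->; rewrite !big_nil !subr0.
have /andP[ba bl'] : (beta <= a) && all (>= beta) l by [].
have a0 : 0 <= a by apply: le_trans ba.
have srt' := path_sorted srt.
have [z0|z0] := ltP z 0.
  move=> /mem_subseq sub /=; rewrite z0 lerBlDr.
  elim: t sub => [|b t IHt] sub; first by rewrite !big_nil addr0 subr0.
  rewrite !big_cons.
  have pos c : c \in b :: t -> 0 <= c.
    by move=> /sub /(allP bl); apply: le_trans.
  have /IHt H : {subset t <= a :: l} by move=> c ct; apply: sub; rewrite inE ct orbT.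
  have t0 : 0 <= \sum_(c <- t) c.
    by rewrite big_seq sumr_ge0 // => c ct; apply: pos; rewrite inE ct orbT.
  have b0 : 0 <= b by apply: pos; rewrite mem_head.
  have := @Pneg (- b) (z - \sum_(c <- t) c) ltac:(lra) ltac:(lra).
  have -> : - b + (z - \sum_(c <- t) c) = z - (b + \sum_(c <- t) c) by lra.
  lra.
rewrite greedy_cons_ge0 //.
have skip u : subseq u l ->
    psi (z - \sum_(b <- u) b) - \sum_(b <- u) psi (- b)
    <= greedy psi l (z - a) - psi (- a).
  move=> /(IH _ z srt' bl') H.
  have l0 : all (>= 0) l by apply: sub_all bl' => c; apply: le_trans.
  have := greedy_subadditive_from Pfrom beta0 srt bl z0 a0.
  rewrite addrK (greedy_le0 (z := - a)) // ?subrr ?greedy0 //; last lra.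
  lra.
case: t => [|b t]; first by move=> _; apply: skip; apply: sub0seq.
rewrite /=; case: eqVneq => [->|_ /skip //] tl.
rewrite !big_cons.
have := IH t (z - a) srt' bl' tl.
rewrite opprD addrA; lra.
Qed.

Lemma greedy_attained l z :
  exists2 q, (q <= size l)%N &
    greedy psi l z = psi (z - \sum_(b <- take q l) b)
                     - \sum_(b <- take q l) psi (- b).
Proof.
elim: l z => [|a l IH] z; first by exists 0%N; rewrite ?take0 ?big_nil ?subr0.
have [z0|z0] := ltP z 0.
  by exists 0%N => //=; rewrite z0 !big_nil !subr0.
have [q ql e] := IH (z - a); exists q.+1 => //.
by rewrite greedy_cons_ge0 //= !big_cons e; rewrite !opprD !addrA addrAC.
Qed.

End Properties.
End GreedyLifting.

(** * Concave bases and equal steps *)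

Section ConcaveBase.
Context {R : realType}.
Implicit Types (H : R -> R) (b c x y z : R).

Lemma concave_subadditive_from H b :
  concave_function H -> subadditive_from H b.
Proof.
move=> cH x y x0 y0.
have [xy0|xy0] := eqVneq (x + y) 0.
  have [-> ->] : x = 0 /\ y = 0 by split; lra.
  by rewrite addr0 !sub0r.
have xyp : 0 < x + y by rewrite lt_neqAle eq_sym xy0 addr_ge0.
pose t := x / (x + y).
have t01 : 0 <= t <= 1.
  by rewrite divr_ge0 ?(ltW xyp) //= ler_pdivrMr // mul1r lerDl.
have ex : x - b = t * (x + y - b) + (1 - t) * (- b) by rewrite /t; field.
have ey : y - b = (1 - t) * (x + y - b) + (1 - (1 - t)) * (- b).
  by rewrite /t; field.
have := cH (x + y - b) (- b) _ t01; rewrite -ex.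
have /cH : 0 <= 1 - t <= 1 by lra.
move=> /(_ (x + y - b) (- b)); rewrite -ey; lra.
Qed.

Lemma subadditive_from_neg H :
  H 0 = 0 -> (forall b, subadditive_from H b) -> subadditive_neg H.
Proof.
move=> H0 Hs x y x0 y0.
have := Hs (- (x + y)) (- x) (- y) ltac:(lra) ltac:(lra).
have -> : - x + - y - - (x + y) = 0 by lra.
have -> : - x - - (x + y) = y by lra.
have -> : - y - - (x + y) = x by lra.
rewrite opprK H0; lra.
Qed.

Lemma subadditive_from_nonneg H :
  H 0 = 0 -> subadditive_from H 0 -> subadditive_nonneg H.
Proof. by move=> H0 Hs x y x0 y0; have := Hs _ _ x0 y0; rewrite oppr0 !addr0 H0 addr0. Qed.

Lemma sorted_nseq n c : sorted >=%R (nseq n c).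
Proof. by elim: n => [//|[//|n] IH] /=; rewrite lexx. Qed.

Lemma sum_nseq (T : Type) n (x : T) (F : T -> R) :
  \sum_(i <- nseq n x) F i = n%:R * F x.
Proof.
by elim: n => [|n IH] /=; rewrite ?big_nil ?mul0r // big_cons IH -nat1r mulrDl mul1r.
Qed.

Section EqualSteps.
Context (H : R -> R) (H0 : H 0 = 0) (cH : concave_function H).
Context (c : R) (c0 : 0 < c).

Let Hfrom b : subadditive_from H b := concave_subadditive_from b cH.
Let Hneg : subadditive_neg H := subadditive_from_neg H0 Hfrom.
Let Hnonneg : subadditive_nonneg H := subadditive_from_nonneg H0 (Hfrom 0).

Notation steps n := (greedy H (nseq n c)).

Lemma stepsE n u z : (u <= n)%N ->
  (u = 0%N) \/ u.-1%:R * c <= z -> (u = n) \/ z <= u%:R * c ->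
  steps n z = H (z - u%:R * c) - u%:R * H (- c).
Proof.
elim: u n z => [|u IH] n z.
  rewrite !mul0r !subr0 => _ _ [<-//|z0].
  by rewrite greedy_le0 // all_nseq (ltW c0) orbT.
case: n => [//|n] un [//|uz] zu /=.
have z0 : 0 <= z by apply: le_trans uz; rewrite mulr_ge0 // ltW.
rewrite ltNge z0 /= (IH n) //.
- rewrite -nat1r !mulrDl !mul1r opprD addrA; lra.
- case: (u) uz => [|v] /= uz; [by left|right].
  by move: uz; rewrite -nat1r mulrDl; lra.
- case: zu => [[->]|zu]; [by left|right].
  by move: zu; rewrite -nat1r mulrDl; lra.
Qed.

Let nseq0 n : all (>= 0) (nseq n c).
Proof. by rewrite all_nseq (ltW c0) orbT. Qed.

Lemma steps_shift j n z : - c <= z ->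
  steps (n + j) (z + j%:R * c) = steps n z - j%:R * H (- c).
Proof.
move=> z0; elim: j => [|j IH]; first by rewrite addn0 !mul0r addr0 subr0.
have jc : 0 <= j%:R * c by rewrite mulr_ge0 // ltW.
rewrite addnS /= ltNge.
have e : z + j.+1%:R * c - c = z + j%:R * c by rewrite -nat1r; lra.
have -> /= : 0 <= z + j.+1%:R * c by rewrite -nat1r mulrDl; lra.
by rewrite e IH -nat1r mulrDl; lra.
Qed.

Lemma steps_extend j n z : z <= n%:R * c -> steps (n + j) z = steps n z.
Proof.
elim: n z => [|n IH] z /=.
  by rewrite mul0r add0n => z0; rewrite greedy_le0.
rewrite -nat1r mulrDl mul1r => zn; case: ifP => // _; rewrite IH //; lra.
Qed.

Lemma steps_subadditive n : subadditive_nonneg (steps n).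
Proof.
apply: (@greedy_subadditive _ H H0 Hneg Hnonneg 0) => //; exact: sorted_nseq.
Qed.

Context (m k : nat).

Definition periodized z : R := steps (m + k) (z + m%:R * c) + m%:R * H (- c).

Lemma periodized0 : periodized 0 = 0.
Proof.
rewrite /periodized (stepsE (u := m)) ?leq_addr //; last by right; rewrite add0r.
  by rewrite add0r subrr H0; lra.
case: (m) => [|m'] /=; [by left|right].
by rewrite add0r ler_pM2r // ler_nat.
Qed.

Lemma periodized_from b :
  (m%:R + 1) * c <= b -> subadditive_from periodized b.
Proof.
move=> mb x y x0 y0; have bc : c <= b - m%:R * c by move: mb; rewrite mulrDl; lra.
have := @greedy_subadditive_from _ H H0 Hneg c (nseq (m + k) c) (b - m%:R * c)
  (fun z _ => Hfrom z) (ltW c0).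
have -> : sorted >=%R (b - m%:R * c :: nseq (m + k) c).
  by have := sorted_nseq (m + k) c; case: (m + k)%N => //= n' ->; rewrite bc.
rewrite /= bc all_nseq lexx orbT => /(_ isT isT x y x0 y0).
rewrite /periodized.
have -> : x + y - (b - m%:R * c) = x + y - b + m%:R * c by lra.
have -> : x - (b - m%:R * c) = x - b + m%:R * c by lra.
have -> : y - (b - m%:R * c) = y - b + m%:R * c by lra.
have -> : - (b - m%:R * c) = - b + m%:R * c by lra.
lra.
Qed.

Lemma periodized_ge0 z : 0 <= z -> periodized z = steps k z.
Proof.
by move=> z0; rewrite /periodized addnC steps_shift ?subrK //; have := c0; lra.
Qed.

Lemma periodized_nonneg : subadditive_nonneg periodized.
Proof.
move=> x y x0 y0; rewrite !periodized_ge0 ?addr_ge0 //.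
exact: steps_subadditive.
Qed.

(* Within the periodic range, shifting by multiples of [c] moves both arguments
   to the nonnegative side, where [steps] is subadditive. *)
Lemma periodized_neg : subadditive_neg periodized.
Proof.
move=> x y x0 y0; have cpos := c0.
have [xy|xy] := leP (x + y) (- ((m%:R + 1) * c)).
  have := @periodized_from (- (x + y)) ltac:(lra) (- x) (- y) ltac:(lra) ltac:(lra).
  have -> : - x + - y - - (x + y) = 0 by lra.
  have -> : - x - - (x + y) = y by lra.
  have -> : - y - - (x + y) = x by lra.
  rewrite opprK periodized0; lra.
have mc0 : 0 <= m%:R * c by rewrite mulr_ge0 // ltW.
have mc : (m%:R + 1) * c = m%:R * c + c by lra.
have shift z : - ((m%:R + 1) * c) <= z -> z <= 0 ->
    steps (m + k + m.+2) (z + (m%:R + 1) * c) = periodized z - (m%:R + 1) * H (- c).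
  move=> zm z0; rewrite addnS -addSn steps_extend; last first.
    apply: (@le_trans _ _ ((m%:R + 1) * c)); first lra.
    by rewrite ler_pM2r // natr1 ler_nat ltnS leq_addr.
  have := @steps_shift 1 (m + k) (z + m%:R * c) ltac:(lra).
  rewrite addn1 mul1r -addrA -mc /periodized => ->; lra.
have := @steps_subadditive (m + k + m.+2) (x + (m%:R + 1) * c) (y + (m%:R + 1) * c)
  ltac:(lra) ltac:(lra).
rewrite (shift x) ?(shift y) //; [|lra|lra].
have -> : x + (m%:R + 1) * c + (y + (m%:R + 1) * c) = x + y + m%:R * c + m.+2%:R * c.
  by rewrite -addn2 natrD; lra.
rewrite steps_shift; last lra.
rewrite /periodized -[m.+2]addn2 natrD; lra.
Qed.

Lemma periodized_ge u z : (u <= m + k)%N ->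
  H (z + (m%:R - u%:R) * c) + (m%:R - u%:R) * H (- c) <= periodized z.
Proof.
move=> un; rewrite /periodized.
have sub : subseq (nseq u c) (nseq (m + k) c).
  by rewrite -(subnKC un) nseqD prefix_subseq.
have := @greedy_ge _ H H0 Hneg 0 (nseq (m + k) c) (nseq u c) (z + m%:R * c)
  (fun b _ => Hfrom b) (lexx _) (sorted_nseq _ _) (nseq0 _) sub.
rewrite !sum_nseq.
have -> : z + m%:R * c - u%:R * c = z + (m%:R - u%:R) * c by lra.
lra.
Qed.

Lemma periodized_attained z : exists2 u, (u <= m + k)%N &
  periodized z = H (z + (m%:R - u%:R) * c) + (m%:R - u%:R) * H (- c).
Proof.
have [u] := greedy_attained H (nseq (m + k) c) (z + m%:R * c).
rewrite size_nseq => um; rewrite take_nseq // !sum_nseq => e; exists u => //.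
rewrite /periodized e.
have -> : z + m%:R * c - u%:R * c = z + (m%:R - u%:R) * c by lra.
lra.
Qed.

End EqualSteps.
End ConcaveBase.

(** * A facet criterion *)

Section FacetCriterion.
Context {R : realType} {n : nat}.
Local Notation V := (R^o * 'rV[R]_n)%type.
Context (X : set V) (c : 'I_n -> R) (c0 : R).

Let rhs (p : V) : R := \sum_i c i * p.2 0 i + c0.

Let slack (p : V) : R^o := \sum_i c i * p.2 0 i - p.1.

Let slack_linear : linear slack.
Proof.
move=> t p q; rewrite /slack scalerBr /GRing.scale /= mulr_sumr.
under eq_bigr => i _ do rewrite !mxE mulrDr mulrCA.
by rewrite big_split opprD addrACA.
Qed.

#[local] HB.instance Definition _ := GRing.isLinear.Build R V R^o _ slack slack_linear.

Lemma affine_function_fst : @affine_function R V (fun p => p.1).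
Proof. by []. Qed.

Lemma affine_function_rhs : affine_function rhs.
Proof.
move=> p q t; rewrite /rhs /= !mulrDr !mulr_sumr.
under eq_bigr => i _ do rewrite !mxE mulrDr !(mulrCA (c i)).
rewrite big_split /=; lra.
Qed.

Lemma conv_hull_valid : (forall p, X p -> p.1 <= rhs p) ->
  forall p, conv_hull X p -> p.1 <= rhs p.
Proof.
move=> valid; apply: smallest_sub => // x y t /set_mem xA /set_mem yA.
have t0 : 0 <= t%:num by [].
have t1 : 0 <= 1 - t%:num by rewrite subr_ge0.
apply/mem_set => /=.
have := affine_function_rhs x y t%:num; rewrite /conv /= /unstable.onem => ->.
by apply: lerD; apply: ler_wpM2l.
Qed.

Lemma dim_mixed_space : \dim {: V} = n.+1.
Proof. by rewrite dimvf -[LHS]/(1 + 1 * n)%N mul1n. Qed.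

Lemma size_affinely_independent (ps : seq V) :
  affinely_independent ps -> (size ps <= n.+2)%N.
Proof.
case: ps => [//|x ps] /= /eqP; rewrite size_map => <-.
by rewrite ltnS -dim_mixed_space dimvS ?subvf.
Qed.

Lemma affinely_independent_off_hyperplane (x q : V) (ps : seq V) :
  (forall y, y \in x :: ps -> y.1 = rhs y) -> q.1 <> rhs q ->
  affinely_independent (x :: ps) -> affinely_independent [:: x, q & ps].
Proof.
move=> on off /= fr; rewrite free_cons fr andbT; apply/negP => qs.
have slackE y : slack y = rhs y - y.1 - c0 by rewrite /slack /rhs; lra.
have slackB u v : slack (u - v) = slack u - slack v by exact: (linearB slack).
have kerE v : (v \in lker (linfun slack)) = (slack v == 0) by rewrite memv_ker lfunE.
have ker : (<<[seq y - x | y <- ps]>> <= lker (linfun slack))%VS.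
  apply/span_subvP => _ /mapP[y yps ->].
  rewrite kerE slackB !slackE !on ?inE ?eqxx ?yps ?orbT //.
  by apply/eqP; lra.
have /(_ _ qs) := subvP ker.
rewrite kerE slackB !slackE (on x) ?mem_head // => /eqP.
rewrite /= => e; apply: off; move: e; lra.
Qed.

Lemma span_triangular (U : {vspace V}) (d : 'I_n -> V) (rk : 'I_n -> nat) :
  ((1, 0) : V) \in U -> (forall i, d i \in U) ->
  (forall i, (d i).2 0 i != 0) ->
  (forall i j, j != i -> (d i).2 0 j != 0 -> (rk j < rk i)%N) ->
  U = fullv.
Proof.
move=> vU dU diag tri.
have dec (p : V) : p = p.1 *: ((1, 0) : V) + \sum_i p.2 0 i *: ((0, delta_mx 0 i) : V).
  have e2 : (\sum_i p.2 0 i *: ((0, delta_mx 0 i) : V)).2 = p.2.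
    rewrite [RHS]row_sum_delta (big_morph snd (id1 := 0) (op1 := +%R)) //.
  have e1 : (\sum_i p.2 0 i *: ((0, delta_mx 0 i) : V)).1 = 0.
    rewrite (big_morph fst (id1 := 0) (op1 := +%R)) // big1 // => i _.
    by rewrite /= /GRing.scale /= mulr0.
  move: e1 e2; case: (\sum_i _) => u w /= -> ->; case: p => a b.
  by congr (_, _) => /=; rewrite ?scaler0 ?add0r // addr0 /GRing.scale /= mulr1.
have eU i : ((0, delta_mx 0 i) : V) \in U.
  elim/ltn_ind: {i}(rk i) {-2}i (erefl (rk i)) => r IH i ri.
  have : (d i).2 0 i *: ((0, delta_mx 0 i) : V) \in U.
    have -> : (d i).2 0 i *: ((0, delta_mx 0 i) : V) =
        d i - (d i).1 *: ((1, 0) : V)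
          - \sum_(j | j != i) (d i).2 0 j *: ((0, delta_mx 0 j) : V).
      have := dec (d i); rewrite (bigD1 i) //= => e.
      by rewrite [X in X - _ - _]e [_ + (_ + _)]addrC !addrK.
    rewrite !rpredB ?rpredZ ?dU // rpred_sum // => j ji.
    have [->|z] := eqVneq ((d i).2 0 j) 0; first by rewrite scale0r rpred0.
    by rewrite rpredZ // (IH (rk j)) // -ri tri.
  by rewrite rpredZeq (negPf (diag i)).
apply: subv_anti; rewrite subvf; apply/subvP => p _.
by rewrite (dec p) rpredD ?rpredZ // rpred_sum // => i _; rewrite rpredZ.
Qed.

Lemma facet_criterion (p0 : V) (pt : 'I_n -> V) (rk : 'I_n -> nat) :
  (forall p, X p -> p.1 <= rhs p) ->
  X p0 -> p0.1 = rhs p0 -> X (p0 - (1, 0)) ->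
  (forall i, X (pt i)) -> (forall i, (pt i).1 = rhs (pt i)) ->
  (forall i, (pt i).2 0 i != p0.2 0 i) ->
  (forall i j, j != i -> (pt i).2 0 j != p0.2 0 j -> (rk j < rk i)%N) ->
  facet_defining (conv_hull X) (fun p => p.1) rhs.
Proof.
move=> valid Xp0 tp0 Xq Xpt tpt diag tri.
pose q : V := p0 - (1, 0).
have XC p : X p -> conv_hull X p by apply: sub_gen_smallest.
have aff : affinely_independent [:: p0, q & [seq pt i | i <- enum 'I_n]].
  rewrite /affinely_independent /free /=. rewrite 2!size_map size_enum_ord.
  set U := <<_>>%VS; suff -> : U = fullv by rewrite dim_mixed_space.
  apply: (@span_triangular U (fun i => pt i - p0) rk).
  - have -> : ((1, 0) : V) = - (q - p0) by rewrite /q addrAC subrr add0r opprK.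
    by rewrite rpredN memv_span ?mem_head.
  - move=> i; apply: memv_span; rewrite inE -map_comp; apply/orP; right.
    by apply/mapP; exists i; rewrite ?mem_enum.
  - by move=> i; rewrite !mxE subr_eq0.
  - by move=> i j ji; rewrite !mxE subr_eq0; apply: tri.
split; [exact: affine_function_fst|exact: affine_function_rhs|exact: conv_hull_valid|].
exists n.+1%:Z; split; split.
- exists [:: p0, q & [seq pt i | i <- enum 'I_n]]; split=> //.
    by move=> x; rewrite !inE => /or3P[/eqP->|/eqP->|/mapP[i _ ->]]; apply: XC.
  by rewrite /= size_map size_enum_ord -PoszD addn1.
- by move=> ps _ /size_affinely_independent; rewrite -PoszD addn1 lez_nat.
- exists (p0 :: [seq pt i | i <- enum 'I_n]); split.
  + move=> x; rewrite inE => /orP[/eqP->|/mapP[i _ ->]]; split=> //=; exact: XC.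
  + by move: aff; rewrite /= free_cons => /andP[].
  + by rewrite /= size_map size_enum_ord; lia.
- move=> [_|x ps on aps]; first by rewrite subrK.
  have off : q.1 <> rhs q.
    rewrite /q /=; move: tp0; rewrite /rhs => ->.
    under [X in _ <> X + _]eq_bigr => i _ do rewrite !mxE subr0.
    by lra.
  have := affinely_independent_off_hyperplane (fun y yps => (on y yps).2) off aps.
  by move=> /size_affinely_independent /=; lia.
Qed.

End FacetCriterion.

(** * Facets from subadditive lifting functions *)

Section SubadditiveSums.
Context {R : realFieldType} (phi : R -> R).
Context (phi0 : phi 0 = 0) (phi_sub : subadditive_nonneg phi).

Lemma subadditive_natmul (c : R) n : 0 <= c -> phi (c * n%:R) <= phi c * n%:R.
Proof.
move=> c0; elim: n => [|n IH]; first by rewrite !mulr0 phi0.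
rewrite -nat1r !mulrDr !mulr1.
by apply: le_trans (phi_sub _ _) _; rewrite ?mulr_ge0 // lerD2l.
Qed.

Lemma subadditive_sum (I : finType) (A : {set I}) (c : I -> R) (x : I -> nat) :
  (forall i, 0 <= c i) ->
  phi (\sum_(i in A) c i * (x i)%:R) <= \sum_(i in A) phi (c i) * (x i)%:R.
Proof.
move=> c0.
suff [] : 0 <= \sum_(i in A) c i * (x i)%:R /\
  phi (\sum_(i in A) c i * (x i)%:R) <= \sum_(i in A) phi (c i) * (x i)%:R by [].
elim/big_rec2: _ => [|i u v _ [v0 vu]]; first by rewrite phi0.
have cx : 0 <= c i * (x i)%:R by rewrite mulr_ge0.
split; first by rewrite addr_ge0.
by apply: le_trans (phi_sub cx v0) _; rewrite lerD // subadditive_natmul.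
Qed.

End SubadditiveSums.

Section LiftingFacet.
Context (R : realType) (n : nat) (f : R -> R) (a : 'rV[R]_n) (mu : 'I_n -> nat).
Context (ha : forall i, 0 <= a 0 i) (hmu : forall i, (1 <= mu i)%N).
Context (s : 'I_n) (S0 S1 : {set 'I_n}).
Context (hS0 : s \notin S0) (hS1 : s \notin S1) (hdisj : [disjoint S0 & S1]).
Context (hcover : s |: (S0 :|: S1) = [set: 'I_n]%SET).
Context (k : nat) (hk : (1 <= k <= mu s)%N) (phi : R -> R).

Local Notation g := (g f a mu S1).
Local Notation rho := (rho f a mu s S1 k).
Local Notation zeta := (zeta f a mu s S1 k).
Local Notation V := (R^o * 'rV[R]_n)%type.

Definition zeta_term (delta : R) (x : nat) : R :=
  g (delta + a 0 s * x%:R) - rho * (x%:R - k%:R) - g (k%:R * a 0 s).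

Lemma zeta_ge delta x : (x <= mu s)%N -> zeta_term delta x <= zeta delta.
Proof.
move=> xm; rewrite /Defs.zeta.
by have := @le_bigmax _ _ _ (zeta_term delta 0) (fun i : 'I_(mu s).+1 => zeta_term delta i)
  (Ordinal (xm : (x < (mu s).+1)%N)).
Qed.

Lemma zeta_attained delta :
  exists2 x, (x <= mu s)%N & zeta delta = zeta_term delta x.
Proof.
rewrite /Defs.zeta; apply: (big_ind (fun v => exists2 x, (x <= mu s)%N & v = zeta_term delta x)).
- by exists 0%N.
- by move=> u v [x xm ->] [y ym ->]; rewrite maxElt; case: ifP => _; [exists y|exists x].
- by move=> i _; exists i => //; rewrite -ltnS.
Qed.

Lemma sum_cover (F : 'I_n -> R) :
  \sum_i F i = F s + \sum_(i in S0) F i + \sum_(i in S1) F i.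
Proof.
have -> : \sum_i F i = \sum_(i in [set: 'I_n]) F i by apply: eq_bigl => i; rewrite inE.
rewrite -hcover big_setU1 ?inE ?negb_or ?hS0 //=.
by rewrite -addrA -bigU //=; congr (_ + _); apply: eq_bigl => i; rewrite !inE.
Qed.

(* Variables indexed by [S1] are complemented. *)
Definition complemented (y : 'I_n -> nat) : 'rV[R]_n :=
  \row_i (if i \in S1 then (mu i)%:R - (y i)%:R else (y i)%:R).

Definition lifted_term (delta : R) (y : 'I_n -> nat) : R :=
  g (delta + a 0 s * (y s)%:R - \sum_(i in S1) a 0 i * (y i)%:R)
  - \sum_(i in S1) zeta (- a 0 i) * (y i)%:R
  - rho * ((y s)%:R - k%:R) - g (k%:R * a 0 s).

Let rhs (p : V) : R :=
  \sum_(i in S1) zeta (- a 0 i) * ((mu i)%:R - p.2 0 i)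
  + \sum_(i in S0) phi (a 0 i) * p.2 0 i
  + rho * (p.2 0 s - k%:R) + g (k%:R * a 0 s).

Let inS0 i : i \in S0 -> i \in S1 = false.
Proof. by move=> iS0; rewrite (disjointFr hdisj). Qed.

Lemma complemented_weight y :
  f (\sum_i a 0 i * complemented y 0 i) =
  g (\sum_(i in S0) a 0 i * (y i)%:R + a 0 s * (y s)%:R
     - \sum_(i in S1) a 0 i * (y i)%:R).
Proof.
rewrite /Defs.g sum_cover !mxE (negPf hS1); congr f.
under [X in _ + X + _ = _]eq_bigr => i iS0 do rewrite mxE inS0 //.
under [X in _ + _ + X = _]eq_bigr => i iS1 do rewrite mxE iS1 mulrBr [a 0 i * (mu i)%:R]mulrC.
rewrite sumrB; lra.
Qed.

Lemma complemented_rhs (w : R) y :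
  rhs (w, complemented y) =
  \sum_(i in S1) zeta (- a 0 i) * (y i)%:R
  + \sum_(i in S0) phi (a 0 i) * (y i)%:R
  + rho * ((y s)%:R - k%:R) + g (k%:R * a 0 s).
Proof.
rewrite /rhs /= !mxE (negPf hS1); congr (_ + _ + _ + _); apply: eq_bigr => i iS.
  by rewrite mxE iS subKr.
by rewrite mxE inS0.
Qed.

Lemma mixed_set_complemented (w : R) y : (forall i, (y i <= mu i)%N) ->
  w <= f (\sum_i a 0 i * complemented y 0 i) ->
  mixed_set f a mu (w, complemented y).
Proof.
move=> ym wf; split => //= i; rewrite mxE; case: ifP => _; split.
- by rewrite rpredB // natr_int.
- by rewrite subr_ge0 ler_nat.
- by rewrite gerBl.
- by rewrite natr_int.
- by [].
- by rewrite ler_nat.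
Qed.

Lemma mixed_setP (p : V) : mixed_set f a mu p ->
  exists2 y, (forall i, (y i <= mu i)%N) & p = (p.1, complemented y).
Proof.
case=> _ px.
have /choice[x xE] : forall i, exists x : nat, p.2 0 i = x%:R /\ (x <= mu i)%N.
  move=> i; have [pint p0 pm] := px i.
  have /natrP[x xE] : p.2 0 i \is a Num.nat by rewrite natrEint pint.
  by exists x; split=> //; move: pm; rewrite xE ler_nat.
exists (fun i => if i \in S1 then mu i - x i else x i)%N.
  by move=> i; case: ifP => _; [exact: leq_subr|case: (xE i)].
rewrite [LHS]surjective_pairing; congr (_, _); apply/rowP => i; rewrite mxE.
have [-> xm] := xE i => /=; case: (i \in S1) => //.
by rewrite natrB // subKr.
Qed.

Context (phi0 : phi 0 = 0) (phi_sub : subadditive_nonneg phi).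
Context (phi_ge : forall delta y, 0 <= delta -> (forall i, (y i <= mu i)%N) ->
  lifted_term delta y <= phi delta).
Context (phi_attained : forall delta, 0 <= delta ->
  exists2 y, (forall i, (y i <= mu i)%N) & phi delta = lifted_term delta y).

Lemma lifted_inequality_valid p : mixed_set f a mu p -> p.1 <= rhs p.
Proof.
move=> /[dup] /mixed_setP[y ym ->] [/= pf _]; apply: le_trans pf _.
rewrite complemented_weight complemented_rhs.
have S00 : 0 <= \sum_(i in S0) a 0 i * (y i)%:R.
  by apply: sumr_ge0 => i _; rewrite mulr_ge0.
have := phi_ge S00 ym; rewrite /lifted_term.
have := subadditive_sum phi0 phi_sub S0 y ha; lra.
Qed.

Definition base_config : 'I_n -> nat := fun i => if i == s then k else 0%N.

Definition config_rank (i : 'I_n) : nat :=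
  if i == s then 0%N else if i \in S1 then 1%N else 2%N.

Lemma sum_zero (A : {set 'I_n}) (F : 'I_n -> R) (y : 'I_n -> nat) :
  (forall i, i \in A -> y i = 0%N) -> \sum_(i in A) F i * (y i)%:R = 0.
Proof. by move=> y0; rewrite big1 // => i /y0 ->; rewrite mulr0. Qed.

Lemma sum_one (A : {set 'I_n}) (F : 'I_n -> R) (y : 'I_n -> nat) i :
  i \in A -> y i = 1%N -> (forall j, j \in A -> j != i -> y j = 0%N) ->
  \sum_(j in A) F j * (y j)%:R = F i.
Proof.
move=> iA yi y0; rewrite (bigD1 i) //= yi mulr1 big1 ?addr0 // => j /andP[jA ji].
by rewrite y0 ?mulr0.
Qed.

Let notin_s (A : {set 'I_n}) i : s \notin A -> i \in A -> (i == s) = false.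
Proof. by move=> sA iA; apply: contraNF sA => /eqP <-. Qed.

Lemma tight_configs i : exists y : 'I_n -> nat,
  [/\ forall j, (y j <= mu j)%N,
      f (\sum_j a 0 j * complemented y 0 j) = rhs (0, complemented y),
      y i != base_config i
    & forall j, j != i -> y j != base_config j -> (config_rank j < config_rank i)%N].
Proof.
have /andP[k1 km] := hk.
have [is_|is_] := eqVneq i s.
  exists (fun j => if j == s then k.-1 else 0%N); rewrite /base_config is_; split.
  - by move=> j; case: eqP => [->|//]; lia.
  - rewrite complemented_weight complemented_rhs eqxx.
    rewrite !sum_zero //; try by move=> j /notin_s -> //.
    rewrite /Defs.rho -subn1 natrB //.
    have -> : 0 + a 0 s * (k%:R - 1) - 0 = (k%:R - 1) * a 0 s by ring.
    by ring.
  - by rewrite eqxx; lia.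
  - by move=> j /negPf ->.
have [iS1|iS1] := boolP (i \in S1).
  have [x xm xE] := zeta_attained (- a 0 i).
  exists (fun j => if j == s then x else (j == i)%N); rewrite /base_config; split.
  - move=> j; case: eqP => [->//|_]; case: eqP => [_|//]; exact: hmu.
  - rewrite complemented_weight complemented_rhs eqxx.
    rewrite [\sum_(j in S1) a 0 j * _](@sum_one _ _ _ i) ?(negPf is_) ?eqxx //; last first.
      by move=> j jS1 /negPf ->; rewrite (notin_s _ jS1).
    rewrite [\sum_(j in S1) _ * _](@sum_one _ _ _ i) ?(negPf is_) ?eqxx //; last first.
      by move=> j jS1 /negPf ->; rewrite (notin_s _ jS1).
    have S0z j : j \in S0 -> (if j == s then x else (j == i)%N) = 0%N.
      move=> jS0; rewrite (notin_s _ jS0) //; case: eqP => // ji.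
      by have := inS0 jS0; rewrite ji iS1.
    rewrite !sum_zero // xE /zeta_term.
    have -> : 0 + a 0 s * x%:R - a 0 i = - a 0 i + a 0 s * x%:R by ring.
    by ring.
  - by rewrite (negPf is_) eqxx.
  - move=> j /negPf ->; rewrite /config_rank (negPf is_) iS1.
    by case: (j == s).
have iS0 : i \in S0.
  have : i \in s |: (S0 :|: S1) by rewrite hcover inE.
  by rewrite !inE (negPf is_) (negPf iS1) orbF.
have [y ym yE] := phi_attained (ha i).
exists (fun j => if j \in S0 then nat_of_bool (j == i) else y j); rewrite /base_config; split.
- by move=> j; case: ifP => // _; case: eqP => [_|//]; apply: hmu.
- rewrite complemented_weight complemented_rhs (negPf hS0).
  rewrite [\sum_(j in S0) a 0 j * _](@sum_one _ _ _ i) ?iS0 ?eqxx //; last first.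
    by move=> j -> /negPf ->.
  rewrite [\sum_(j in S0) _ * _](@sum_one _ _ _ i) ?iS0 ?eqxx //; last first.
    by move=> j -> /negPf ->.
  have S1y (F : 'I_n -> R) :
      \sum_(j in S1) F j * (if j \in S0 then nat_of_bool (j == i) else y j)%:R =
      \sum_(j in S1) F j * (y j)%:R.
    by apply: eq_bigr => j jS1; rewrite (disjointFl hdisj jS1).
  rewrite !S1y yE /lifted_term; ring.
- by rewrite iS0 (negPf is_) eqxx.
- move=> j /negPf ji; rewrite ji /config_rank (negPf is_) (negPf iS1).
  case: (eqVneq j s) => // js; case: ifP => // jS0.
  have : j \in s |: (S0 :|: S1) by rewrite hcover inE.
  by rewrite !inE (negPf js) jS0 /= => ->.
Qed.

Lemma lifting_facet :
  facet_defining (conv_hull (mixed_set f a mu)) (fun p : V => p.1) rhs.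
Proof.
pose c i := if i \in S1 then - zeta (- a 0 i) else if i == s then rho else phi (a 0 i).
pose c0 := \sum_(i in S1) zeta (- a 0 i) * (mu i)%:R - rho * k%:R + g (k%:R * a 0 s).
have rhsE : rhs = fun p : V => \sum_i c i * p.2 0 i + c0.
  apply/funext => p; rewrite /rhs sum_cover /c (negPf hS1) eqxx.
  under [X in _ = _ + X + _ + _]eq_bigr => i iS do rewrite inS0 // (notin_s _ iS) //.
  under [X in _ = _ + _ + X + _]eq_bigr => i iS do rewrite iS mulNr.
  under [X in X + _ + _ + _ = _]eq_bigr => i _ do rewrite mulrBr.
  rewrite sumrB sumrN /c0; ring.
have [pt ptE] := choice tight_configs.
pose P (y : 'I_n -> nat) : V := (f (\sum_j a 0 j * complemented y 0 j), complemented y).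
have diffE (y z : 'I_n -> nat) i :
    (complemented y 0 i != complemented z 0 i) = (y i != z i).
  by rewrite !mxE; case: ifP => _; rewrite ?(inj_eq (addrI _)) ?eqr_opp eqr_nat.
have bm i : (base_config i <= mu i)%N.
  by rewrite /base_config; case: eqP => [->|//]; case/andP: hk.
have tight y : f (\sum_j a 0 j * complemented y 0 j) = rhs (0, complemented y) ->
    (P y).1 = rhs (P y) by rewrite /P !complemented_rhs.
have tight0 : (P base_config).1 = rhs (P base_config).
  apply: tight; rewrite complemented_weight complemented_rhs /base_config eqxx.
  rewrite !sum_zero; try by move=> j /notin_s -> //.
  by rewrite add0r subr0 mulrC subrr mulr0 !add0r.
have := lifted_inequality_valid; rewrite rhsE => valid.
apply: (@facet_criterion R n _ c c0 (P base_config) (P \o pt) config_rank) => //.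
- exact: mixed_set_complemented.
- by move: tight0; rewrite rhsE.
- rewrite /P -[_ - _]/(_ - 1, _ - 0) subr0.
  by apply: mixed_set_complemented => //; rewrite gerBl.
- by move=> i; have [ym _ _ _] := ptE i; apply: mixed_set_complemented.
- move=> i; have [_ e _ _] := ptE i.
  by have := tight _ e; rewrite rhsE.
- by move=> i; have [_ _ e _] := ptE i; rewrite diffE.
- by move=> i j; have [_ _ _ e] := ptE i; rewrite diffE; apply: e.
Qed.

End LiftingFacet.

(** * Lists of items *)

Section Items.
Context {R : realType} {n : nat} (a : 'rV[R]_n) (mu : 'I_n -> nat).
Context (ha : forall i, 0 <= a 0 i).
Implicit Types (js : seq 'I_n) (psi : R -> R).

Definition copies (y : 'I_n -> nat) js : seq R :=
  flatten [seq nseq (y j) (a 0 j) | j <- js].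

Local Notation items := (copies mu).

Lemma sum_copies y js (F : R -> R) :
  \sum_(b <- copies y js) F b = \sum_(j <- js) (y j)%:R * F (a 0 j).
Proof.
by rewrite big_flatten big_map; apply: eq_bigr => j _; rewrite sum_nseq.
Qed.

Lemma copies_cons y j js : copies y (j :: js) = nseq (y j) (a 0 j) ++ copies y js.
Proof. by []. Qed.

Lemma copies_cat y js1 js2 : copies y (js1 ++ js2) = copies y js1 ++ copies y js2.
Proof. by rewrite /copies map_cat flatten_cat. Qed.

Lemma all_copies (p : pred R) y js :
  (forall j, j \in js -> p (a 0 j)) -> all p (copies y js).
Proof.
move=> pj; apply/allP => b /flattenP[_ /mapP[j jjs ->] /nseqP[-> _]].
exact: pj.
Qed.

Lemma copies_ge0 y js : all (>= 0) (copies y js).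
Proof. exact: all_copies. Qed.

Lemma sorted_copies y js :
  sorted (fun i j => a 0 j <= a 0 i) js -> sorted >=%R (copies y js).
Proof.
have tr1 : transitive (fun i j => a 0 j <= a 0 i) by move=> u v w /[swap]; apply: le_trans.
have tr2 : transitive (>=%R : rel R) by move=> u v w /[swap]; apply: le_trans.
rewrite !sorted_pairwise //; elim: js => [//|j js IH] /= /andP[jall srt].
rewrite pairwise_cat IH // -sorted_pairwise // sorted_nseq !andbT.
apply/allrelP => u v /nseqP[-> _].
move=> /flattenP[_ /mapP[i ijs ->] /nseqP[-> _]].
by move/allP: jall; apply.
Qed.

Lemma subseq_copies y js : (forall j, (y j <= mu j)%N) ->
  subseq (copies y js) (items js).
Proof.
move=> ym; elim: js => [//|j js IH]; rewrite !copies_cons cat_subseq //.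
by rewrite -(subnKC (ym j)) nseqD prefix_subseq.
Qed.

Lemma take_items js q : uniq js ->
  exists2 y, (forall j, (y j <= mu j)%N) & take q (items js) = copies y js.
Proof.
elim: js q => [|j js IH] q /=; first by exists (fun=> 0%N).
case/andP => jjs ujs; rewrite !copies_cons take_cat size_nseq.
have upd y u : copies (fun i => if i == j then u else y i) js = copies y js.
  rewrite /copies; congr flatten; apply/eq_in_map => i ijs.
  by case: eqP ijs jjs => // -> ->.
case: ltnP => qj.
  exists (fun i => if i == j then q else 0%N).
    by move=> i; case: eqP => // ->; apply: ltnW.
  rewrite copies_cons eqxx upd take_nseq 1?ltnW //.
  rewrite (_ : copies _ js = [::]) ?cats0 //.
  by rewrite /copies; elim: (js).
have [y ym yE] := IH (q - mu j)%N ujs.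
exists (fun i => if i == j then mu j else y i).
  by move=> i; case: eqP => // ->.
by rewrite copies_cons eqxx upd yE.
Qed.

Section Greedy.
Context (psi : R -> R) (psi0 : psi 0 = 0).

Lemma greedy_end l z : all (>= 0) l -> \sum_(b <- l) b <= z ->
  greedy psi l z = psi (z - \sum_(b <- l) b) - \sum_(b <- l) psi (- b).
Proof.
case: (lastP l) => [|l' b]; first by rewrite !big_nil !subr0.
rewrite all_rcons => /andP[b0 l0] lz.
rewrite -[rcons l' b in LHS]cats0 greedy_rcons_cat //.
by move: lz; rewrite big_rcons /=; move: b0; lra.
Qed.

Lemma greedy_items_in js1 j js2 q z : (0 < q <= mu j)%N ->
  let A := \sum_(i <- js1) (mu i)%:R * a 0 i in
  A + q.-1%:R * a 0 j <= z <= A + q%:R * a 0 j ->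
  greedy psi (items (js1 ++ j :: js2)) z =
    psi (z - (A + q%:R * a 0 j))
    - \sum_(i <- js1) (mu i)%:R * psi (- a 0 i) - q%:R * psi (- a 0 j).
Proof.
move=> /andP[q0 qm] A /andP[Az zA].
have nq : nseq q (a 0 j) = rcons (nseq q.-1 (a 0 j)) (a 0 j).
  by rewrite -cats1 -[[:: _]]/(nseq 1 (a 0 j)) -nseqD addn1 prednK.
have -> : items (js1 ++ j :: js2) =
    rcons (items js1 ++ nseq q.-1 (a 0 j)) (a 0 j)
    ++ (nseq (mu j - q) (a 0 j) ++ items js2).
  by rewrite rcons_cat -nq copies_cat copies_cons -!catA catA catA -[in LHS](subnKC qm) nseqD !catA.
rewrite greedy_rcons_cat //; last 2 first.
- by rewrite all_cat copies_ge0 all_nseq ha orbT.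
- by rewrite big_cat sum_copies sum_nseq.
rewrite rcons_cat -nq !big_cat /= !sum_copies !sum_nseq greedy_le0 //.
- by rewrite -[RHS]addrA -opprD.
- by rewrite all_cat copies_ge0 all_nseq ha orbT.
- by rewrite subr_le0.
Qed.

Lemma greedy_items_end js z : \sum_(i <- js) (mu i)%:R * a 0 i <= z ->
  greedy psi (items js) z =
    psi (z - \sum_(i <- js) (mu i)%:R * a 0 i)
    - \sum_(i <- js) (mu i)%:R * psi (- a 0 i).
Proof. by move=> Az; rewrite greedy_end ?copies_ge0 // !sum_copies. Qed.

Lemma greedy_items_attained js z : uniq js ->
  exists2 y, (forall j, (y j <= mu j)%N) &
    greedy psi (items js) z = psi (z - \sum_(j <- js) (y j)%:R * a 0 j)
      - \sum_(j <- js) (y j)%:R * psi (- a 0 j).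
Proof.
move=> ujs; have [q _ ->] := greedy_attained psi (items js) z.
have [y ym ->] := take_items q ujs.
by exists y; rewrite ?sum_copies.
Qed.

Lemma greedy_items_ge beta js y z : subadditive_neg psi ->
  (forall c, beta <= c -> subadditive_from psi c) -> 0 <= beta ->
  sorted (fun i j => a 0 j <= a 0 i) js ->
  (forall j, j \in js -> beta <= a 0 j) -> (forall j, (y j <= mu j)%N) ->
  psi (z - \sum_(j <- js) (y j)%:R * a 0 j) - \sum_(j <- js) (y j)%:R * psi (- a 0 j)
  <= greedy psi (items js) z.
Proof.
move=> Pneg Pfrom beta0 srt bjs ym.
have := @greedy_ge _ _ psi0 Pneg beta (items js) (copies y js) z Pfrom beta0
  (sorted_copies _ srt) (all_copies _ bjs) (subseq_copies _ ym).
by rewrite !sum_copies.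
Qed.

End Greedy.

Lemma locate_multiple (c z : R) m : 0 <= z < m%:R * c ->
  exists2 q, (0 < q <= m)%N & q.-1%:R * c <= z < q%:R * c.
Proof.
elim: m => [|m IH] /andP[z0 zm]; first by move: zm; rewrite mul0r; lra.
have [zm'|mz] := ltP z (m%:R * c).
  have [|q /andP[q0 qm] zq] := IH; first by rewrite z0.
  by exists q => //; rewrite q0 (leq_trans qm).
by exists m.+1; rewrite ?leqnn //= mz.
Qed.

Lemma locate_item js z : 0 <= z < \sum_(i <- js) (mu i)%:R * a 0 i ->
  exists js1 j js2 q, [/\ js = js1 ++ j :: js2, (0 < q <= mu j)%N &
    let A := \sum_(i <- js1) (mu i)%:R * a 0 i in
    A + q.-1%:R * a 0 j <= z < A + q%:R * a 0 j].
Proof.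
elim: js z => [|j js IH] z; first by rewrite big_nil => /andP[z0 /lt_geF]; rewrite z0.
rewrite big_cons => /andP[z0 zA].
have [zj|jz] := ltP z ((mu j)%:R * a 0 j).
  have [|q qm zq] := @locate_multiple (a 0 j) z (mu j); first by rewrite z0.
  by exists [::], j, js, q; split=> //=; rewrite big_nil !add0r.
have [|js1 [i [js2 [q [-> qm /= zq]]]]] := IH (z - (mu j)%:R * a 0 j).
  by apply/andP; split; lra.
exists (j :: js1), i, js2, q; split=> //=.
by rewrite big_cons; apply/andP; split; case/andP: zq; lra.
Qed.

End Items.

(** * The lifting functions of the theorem *)

Section LiftingFunctions.
Context (R : realType) (n : nat) (f : R -> R) (hf : concave_function f).
Context (a : 'rV[R]_n) (ha : forall i, 0 <= a 0 i) (mu : 'I_n -> nat).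
Context (s : 'I_n) (has : 0 < a 0 s) (S1 : {set 'I_n}).
Context (k : nat) (hk : (1 <= k <= mu s)%N).

Local Notation g := (g f a mu S1).
Local Notation rho := (rho f a mu s S1 k).
Local Notation zeta := (zeta f a mu s S1 k).
Local Notation c := (a 0 s).
Local Notation m := (mu s - k)%N.
Local Notation items := (copies a mu).

Definition centered (z : R) : R := g (z + k%:R * c) - g (k%:R * c).

Lemma centered0 : centered 0 = 0.
Proof. by rewrite /centered add0r subrr. Qed.

Lemma centered_concave : concave_function centered.
Proof.
move=> x y t t01; rewrite /centered /Defs.g.
set B := \sum_(i in S1) _.
have := hf (x + k%:R * c + B) (y + k%:R * c + B) t01.
have -> : t * (x + k%:R * c + B) + (1 - t) * (y + k%:R * c + B) =
  t * x + (1 - t) * y + k%:R * c + B by ring.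
lra.
Qed.

Lemma centered_step : centered (- c) = - rho.
Proof.
rewrite /centered /Defs.rho opprB.
by have -> : - c + k%:R * c = (k%:R - 1) * c by ring.
Qed.

Lemma natr_m : m%:R = (mu s)%:R - k%:R :> R.
Proof. by rewrite natrB //; case/andP: hk. Qed.

Let mk : (m + k = mu s)%N.
Proof. by rewrite subnK //; case/andP: hk. Qed.

Lemma zeta_periodized z : zeta z = periodized centered c m k z.
Proof.
have cH := centered_concave; have H0 := centered0.
apply/eqP; rewrite eq_le; apply/andP; split.
  have [x xm ->] := zeta_attained f a mu s S1 k z.
  have := periodized_ge H0 cH has z (m := m) (k := k) (u := (mu s - x)%N).
  rewrite mk leq_subr => /(_ isT); rewrite natr_m natrB // centered_step.
  rewrite /zeta_term /centered.
  have -> : z + ((mu s)%:R - k%:R - ((mu s)%:R - x%:R)) * c + k%:R * c = z + c * x%:R by ring.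
  lra.
have [u] := periodized_attained centered c m k z.
rewrite mk natr_m centered_step => um ->.
have := zeta_ge f a S1 k z (leq_subr u (mu s)).
rewrite /zeta_term /centered natrB //.
have -> : z + ((mu s)%:R - k%:R - u%:R) * c + k%:R * c = z + c * ((mu s)%:R - u%:R) by ring.
lra.
Qed.

Lemma zetaE u z : (u <= mu s)%N ->
  (u = 0%N) \/ (u.-1%:R - m%:R) * c <= z -> (u = mu s) \/ z <= (u%:R - m%:R) * c ->
  zeta z = g (z + ((mu s)%:R - u%:R) * c) - g (k%:R * c)
           + (k%:R - (mu s)%:R + u%:R) * rho.
Proof.
move=> um uz zu; rewrite zeta_periodized /periodized.
rewrite (stepsE centered0 has (u := u)) ?mk //.
- rewrite centered_step natr_m /centered.
  have -> : z + ((mu s)%:R - k%:R) * c - u%:R * c + k%:R * c = z + ((mu s)%:R - u%:R) * c.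
    by ring.
  ring.
- by case: uz; [left|right; lra].
- by case: zu; [left|right; lra].
Qed.

Lemma zeta0 : zeta 0 = 0.
Proof. by rewrite zeta_periodized periodized0 // centered0. Qed.

Lemma zeta_subadditive_neg : subadditive_neg zeta.
Proof.
move=> x y x0 y0; rewrite !zeta_periodized.
exact: (periodized_neg centered0 centered_concave has).
Qed.

Lemma zeta_subadditive_nonneg : subadditive_nonneg zeta.
Proof.
move=> x y x0 y0; rewrite !zeta_periodized.
exact: (periodized_nonneg centered0 centered_concave has).
Qed.

Lemma zeta_subadditive_from b : (m%:R + 1) * c <= b -> subadditive_from zeta b.
Proof.
move=> mb x y x0 y0; rewrite !zeta_periodized.
exact: (periodized_from centered0 centered_concave has).
Qed.

Lemma zeta_le0_centered z : k = mu s -> z <= 0 -> zeta z = centered z.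
Proof.
move=> km z0; rewrite (zetaE (u := 0)) //; [|by left|by right; rewrite km subnn subrr mul0r].
by rewrite /centered km !mulr0n subr0 subrr addr0 mul0r addr0.
Qed.

Lemma A_size_cat js1 j js2 q :
  A_ a mu s (js1 ++ j :: js2) (size js1) q =
  \sum_(i <- js1) (mu i)%:R * a 0 i + q%:R * a 0 j.
Proof. by rewrite /A_ take_size_cat // nth_cat ltnn subnn. Qed.

Lemma A_size js : A_ a mu s js (size js) 0 = \sum_(i <- js) (mu i)%:R * a 0 i.
Proof. by rewrite /A_ take_size mul0r addr0. Qed.

Lemma zeta_sum_size_cat js1 js2 :
  zeta_sum f a mu s S1 k (js1 ++ js2) (size js1) =
  \sum_(i <- js1) (mu i)%:R * zeta (- a 0 i).
Proof. by rewrite /zeta_sum take_size_cat. Qed.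

Lemma zeta_sum_size js :
  zeta_sum f a mu s S1 k js (size js) = \sum_(i <- js) (mu i)%:R * zeta (- a 0 i).
Proof. by rewrite /zeta_sum take_size. Qed.

Lemma phi_spec_i_greedy js phi : phi_spec_i f a mu s S1 k js phi ->
  forall delta, 0 <= delta -> phi delta = greedy zeta (items js) delta.
Proof.
have /andP[k1 km] := hk.
case; rewrite A_size zeta_sum_size => spec1 spec2 spec3 spec4 d d0.
have rm := natr_m; have c0 := has.
have [dA|Ad] := ltP d (\sum_(i <- js) (mu i)%:R * a 0 i); last first.
  rewrite greedy_items_end //; set A := \sum_(i <- js) _ in Ad spec3 spec4 *.
  have [dk|kd] := ltP d (A + k%:R * c).
    have [|q /andP[q0 qk] /andP[qz zq]] := @locate_multiple R c (d - A) k.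
      by apply/andP; split; lra.
    have q1 : q.-1%:R = q%:R - 1 :> R by rewrite -subn1 natrB.
    have lm : (m + q <= mu s)%N by lia.
    rewrite (spec3 (m + q)%N); last 2 first.
    - by apply/andP; split; lia.
    - by rewrite natrD rm; apply/andP; split; move: qz zq; rewrite q1; lra.
    rewrite (@zetaE (m + q)%N) //.
    + rewrite natrD rm.
      have -> : d + ((mu s)%:R - ((mu s)%:R - k%:R + q%:R)) * c - A =
        d - A + ((mu s)%:R - ((mu s)%:R - k%:R + q%:R)) * c by ring.
      ring.
    + right; have -> : (m + q).-1%:R = m%:R + q%:R - 1 :> R.
        by rewrite -subn1 natrB ?natrD //; lia.
      by move: qz; rewrite q1; lra.
    + by right; rewrite natrD; lra.
  rewrite spec4 // (@zetaE (mu s)) //; last by left.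
    by rewrite subrr mul0r addr0; ring.
  right; rewrite -subn1 natrB; last lia.
  by move: has; rewrite rm; lra.
have [|js1 [j [js2 [q [jsE qm /= /andP[Aq qA]]]]]] := @locate_item R n a mu js d.
  by rewrite d0.
set A := \sum_(i <- js1) _ in Aq qA.
have AE := A_size_cat js1 j js2; rewrite -/A in AE.
have szj : (size js1 < size js)%N by rewrite jsE size_cat /= -addSnnS leq_addr.
have nthj : nth s js (size js1) = j by rewrite jsE nth_cat ltnn subnn.
have zs : zeta_sum f a mu s S1 k js (size js1) = \sum_(i <- js1) (mu i)%:R * zeta (- a 0 i).
  by rewrite jsE zeta_sum_size_cat.
rewrite {1}jsE (greedy_items_in ha zeta0 js2 qm) /=; last by rewrite Aq ltW.
rewrite -/A.
have [dl|ld] := ltP d (A + q%:R * a 0 j + (k%:R - (mu s)%:R - 1) * c).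
  rewrite (spec1 (size js1) q) ?nthj //; rewrite jsE ?AE; last by rewrite Aq dl.
  rewrite -jsE zs (@zetaE 0 (d - (A + q%:R * a 0 j))) //; [|by left|by right; rewrite rm; lra].
  have -> : d + (mu s)%:R * c - (A + q%:R * a 0 j) =
    d - (A + q%:R * a 0 j) + ((mu s)%:R - 0%:R) * c by ring.
  ring.
have [|q' /andP[q0 qk] /andP[qz zq]] :=
  @locate_multiple R c (d - (A + q%:R * a 0 j) + (m%:R + 1) * c) m.+1.
  by rewrite -natr1 rm; apply/andP; split; lra.
have q1 : q'.-1%:R = q'%:R - 1 :> R by rewrite -subn1 natrB.
rewrite (spec2 (size js1) q q'.-1) ?nthj //; rewrite ?jsE ?AE; first last.
- by rewrite q1; move: qz zq; rewrite q1 rm => qz zq; apply/andP; split; lra.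
- by lia.
rewrite -jsE zs (@zetaE q'.-1 (d - (A + q%:R * a 0 j))).
- have -> : d + ((mu s)%:R - q'.-1%:R) * c - (A + q%:R * a 0 j) =
    d - (A + q%:R * a 0 j) + ((mu s)%:R - q'.-1%:R) * c by ring.
  ring.
- by lia.
- case: (q') q0 qz q1 => [|[|l]] // _ /= qz q1; [by left|right].
  by move: qz; rewrite -natr1; lra.
- by right; move: zq; rewrite q1; lra.
Qed.

Lemma phi_spec_ii_greedy js phi : k = mu s -> s \in js ->
  phi_spec_ii f a mu s S1 k js phi ->
  forall delta, 0 <= delta -> phi delta = greedy centered (items js) delta.
Proof.
move=> km sjs [spec1 spec2] d d0.
have zE i : zeta (- a 0 i) = centered (- a 0 i).
  by rewrite zeta_le0_centered // oppr_le0.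
have zsumE l : \sum_(i <- l) (mu i)%:R * zeta (- a 0 i) =
    \sum_(i <- l) (mu i)%:R * centered (- a 0 i).
  by apply: eq_bigr => i _; rewrite zE.
have [dA|Ad] := ltP d (\sum_(i <- js) (mu i)%:R * a 0 i); last first.
  rewrite greedy_items_end //.
  move: Ad spec2 sjs; case/lastP: js {spec1} => [//|js j] Ad spec2 _.
  have Alast : A_ a mu s (rcons js j) (size (rcons js j)).-1
      (mu (nth s (rcons js j) (size (rcons js j)).-1)) =
      \sum_(i <- rcons js j) (mu i)%:R * a 0 i.
    rewrite size_rcons /= nth_rcons ltnn eqxx -cats1 A_size_cat.
    by rewrite big_cat big_seq1.
  move: spec2; rewrite Alast => -> //.
  rewrite prednK ?size_rcons // -(size_rcons js j) zeta_sum_size.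
  rewrite zsumE; set A := \sum_(i <- _) _.
  rewrite /centered km.
  have -> : d + (mu s)%:R * c - A = d - A + (mu s)%:R * c by ring.
  ring.
have [|js1 [j [js2 [q [jsE qm /= /andP[Aq qA]]]]]] := @locate_item R n a mu js d.
  by rewrite d0.
set A := \sum_(i <- js1) _ in Aq qA.
have AE := A_size_cat js1 j js2; rewrite -/A in AE.
have nthj : nth s js (size js1) = j by rewrite jsE nth_cat ltnn subnn.
rewrite {1}jsE (greedy_items_in ha centered0 js2 qm) /=; last by rewrite Aq ltW.
rewrite (spec1 (size js1) q) ?nthj //; rewrite jsE ?AE; last 2 first.
- by rewrite size_cat /= addnS leq_addr.
- have /andP[q0 _] := qm; have : q.-1%:R = q%:R - 1 :> R by rewrite -subn1 natrB.
  by rewrite Aq qA.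
rewrite zeta_sum_size_cat zE zsumE.
rewrite -/A /centered km.
have -> : d + (mu s)%:R * c - (A + q%:R * a 0 j) =
  d - (A + q%:R * a 0 j) + (mu s)%:R * c by ring.
ring.
Qed.

End LiftingFunctions.

Lemma big_enum_set (R : nmodType) (I : finType) (A : {set I}) (js : seq I) (F : I -> R) :
  uniq js -> js =i A -> \sum_(j <- js) F j = \sum_(j in A) F j.
Proof. by move=> ujs jsA; rewrite big_uniq //=; apply: eq_bigl => j; apply: jsA. Qed.

Theorem theorem4p20 (R : realType) (n : nat) (hn : (1 <= n)%N)
  (f : R -> R) (hf : concave_function f)
  (a : 'rV[R]_n) (ha : forall i, 0 <= a 0 i)
  (mu : 'I_n -> nat) (hmu : forall i, (1 <= mu i)%N)
  (s : 'I_n) (has : 0 < a 0 s)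
  (S0 S1 : {set 'I_n})
  (hS0 : s \notin S0) (hS1 : s \notin S1)
  (hdisj : [disjoint S0 & S1])
  (hcover : s |: (S0 :|: S1) = [set: 'I_n]%SET)
  (k : nat) (hk : (1 <= k <= mu s)%N)
  (phi : R -> R) (js : seq 'I_n)
  (hphi :
     [/\ S1plus a mu s S1 k = S1,
         decreasing_enum a (S1plus a mu s S1 k) js
       & phi_spec_i f a mu s S1 k js phi] \/
     [/\ k = mu s,
         decreasing_enum a (s |: S1) js
       & phi_spec_ii f a mu s S1 k js phi]) :
  facet_defining (conv_hull (mixed_set f a mu))
    (fun p => p.1)
    (fun p =>
       \sum_(i in S1) zeta f a mu s S1 k (- a 0 i) * ((mu i)%:R - p.2 0 i)
       + \sum_(i in S0) phi (a 0 i) * p.2 0 i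
       + rho f a mu s S1 k * (p.2 0 s - k%:R)
       + g f a mu S1 (k%:R * a 0 s)).
Proof.
have /andP[k1 km] := hk.
have sumC (l : seq 'I_n) (y : 'I_n -> nat) (F : 'I_n -> R) :
    \sum_(j <- l) (y j)%:R * F j = \sum_(j <- l) F j * (y j)%:R.
  by apply: eq_bigr => j _; rewrite mulrC.
case: hphi => [[S1p [ujs jsS1 srt] spec]|[kmu [ujs jsS1 srt] spec]].
  have phiE := phi_spec_i_greedy hf ha has hk spec.
  have z0 := zeta0 hf has S1 hk.
  have Pneg := @zeta_subadditive_neg _ _ _ hf _ _ _ has S1 _ hk.
  have Pfrom := @zeta_subadditive_from _ _ _ hf _ _ _ has S1 _ hk.
  have beta0 : 0 <= ((mu s - k)%N%:R + 1) * a 0 s :> R by rewrite mulr_ge0 ?addr_ge0 // ltW.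
  have big j : j \in js -> ((mu s - k)%N%:R + 1) * a 0 s <= a 0 j.
    by rewrite jsS1 inE natrB // => /andP[].
  rewrite S1p in jsS1.
  have sumS F := big_enum_set F ujs jsS1.
  apply: (lifting_facet ha hmu hS0 hS1 hdisj hcover hk).
  - by rewrite phiE // greedy0 // copies_ge0.
  - move=> x y x0 y0; rewrite !phiE ?addr_ge0 //.
    apply: (greedy_subadditive z0 Pneg _ Pfrom beta0 (sorted_copies _ srt) (all_copies _ big)) => //.
    exact: zeta_subadditive_nonneg.
  - move=> d y d0 ym; rewrite phiE //.
    apply: le_trans (greedy_items_ge z0 d Pneg Pfrom beta0 srt big ym).
    rewrite !sumC !sumS.
    have := zeta_ge f a S1 k (d - \sum_(i in S1) a 0 i * (y i)%:R) (ym s).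
    rewrite /lifted_term /zeta_term.
    have -> : d + a 0 s * (y s)%:R - \sum_(i in S1) a 0 i * (y i)%:R =
      d - \sum_(i in S1) a 0 i * (y i)%:R + a 0 s * (y s)%:R by ring.
    lra.
  - move=> d d0; rewrite phiE //.
    have [y ym ->] := greedy_items_attained a mu (zeta f a mu s S1 k) d ujs.
    rewrite !sumC !sumS.
    have [x xm ->] := zeta_attained f a mu s S1 k (d - \sum_(i in S1) a 0 i * (y i)%:R).
    exists (fun i => if i == s then x else y i); first by move=> i; case: eqP => // ->.
    have S1y (F : 'I_n -> R) : \sum_(i in S1) F i * (if i == s then x else y i)%:R =
        \sum_(i in S1) F i * (y i)%:R.
      by apply: eq_bigr => i iS1; case: eqP => // e; rewrite -e iS1 in hS1.
    rewrite /lifted_term /zeta_term !S1y eqxx.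
    have -> : d + a 0 s * x%:R - \sum_(i in S1) a 0 i * (y i)%:R =
      d - \sum_(i in S1) a 0 i * (y i)%:R + a 0 s * x%:R by ring.
    ring.
have sjs : s \in js by rewrite jsS1 setU11.
have phiE := phi_spec_ii_greedy hf ha has hk kmu sjs spec.
have H0 := centered0 f a mu s S1 k.
have cH := centered_concave hf a mu s S1 k.
have Hs := centered_step f a mu s S1 k.
set H := centered f a mu s S1 k in phiE H0 cH Hs.
have Pfrom b (_ : 0 <= b) : subadditive_from H b := concave_subadditive_from b cH.
have Pneg : subadditive_neg H.
  by apply: subadditive_from_neg => // b; apply: concave_subadditive_from.
have big j : j \in js -> 0 <= a 0 j by [].
have sumS (F : 'I_n -> R) : \sum_(j <- js) F j = F s + \sum_(j in S1) F j.
  by rewrite (big_enum_set _ ujs jsS1) big_setU1.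
have zE i : zeta f a mu s S1 k (- a 0 i) = H (- a 0 i).
  by rewrite zeta_le0_centered // oppr_le0.
have zsumE (y : 'I_n -> nat) : \sum_(i in S1) zeta f a mu s S1 k (- a 0 i) * (y i)%:R =
    \sum_(i in S1) H (- a 0 i) * (y i)%:R.
  by apply: eq_bigr => i _; rewrite zE.
have termE (d : R) (y z : 'I_n -> nat) : (z s <= mu s)%N -> y s = (mu s - z s)%N ->
    {in S1, y =1 z} ->
    lifted_term f a mu s S1 k d y =
    H (d - \sum_(j <- js) a 0 j * (z j)%:R) - \sum_(j <- js) H (- a 0 j) * (z j)%:R.
  move=> zm yz yzS; rewrite /lifted_term zsumE !sumS Hs.
  have yzE (F : 'I_n -> R) :
      \sum_(i in S1) F i * (y i)%:R = \sum_(i in S1) F i * (z i)%:R.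
    by apply: eq_bigr => i iS1; rewrite yzS.
  rewrite !yzE yz natrB // /H /centered kmu.
  set B := \sum_(i in S1) a 0 i * (z i)%:R.
  have -> : d + a 0 s * ((mu s)%:R - (z s)%:R) - B =
    d - (a 0 s * (z s)%:R + B) + (mu s)%:R * a 0 s by ring.
  ring.
apply: (lifting_facet ha hmu hS0 hS1 hdisj hcover hk).
- by rewrite phiE // greedy0 // copies_ge0.
- move=> x y x0 y0; rewrite !phiE ?addr_ge0 //.
  apply: (greedy_subadditive H0 Pneg _ Pfrom (lexx 0) (sorted_copies _ srt) (all_copies _ big)) => //.
  by apply: subadditive_from_nonneg => //; apply: concave_subadditive_from.
- move=> d y d0 ym; rewrite phiE //.
  pose z i := if i == s then (mu s - y s)%N else y i.
  have zm i : (z i <= mu i)%N by rewrite /z; case: eqP => // ->; exact: leq_subr.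
  have := greedy_items_ge H0 d Pneg Pfrom (lexx 0) srt big zm.
  rewrite !sumC -(termE _ y) //.
  + by rewrite /z eqxx subKn.
  + by move=> i iS1; rewrite /z; case: eqP => // e; rewrite -e iS1 in hS1.
- move=> d d0; rewrite phiE //.
  have [z zm ->] := greedy_items_attained a mu H d ujs.
  pose y i := if i == s then (mu s - z s)%N else z i.
  exists y; first by move=> i; rewrite /y; case: eqP => // ->; exact: leq_subr.
  rewrite !sumC -(termE _ y) //.
  + by rewrite /y eqxx.
  + by move=> i iS1; rewrite /y; case: eqP => // e; rewrite -e iS1 in hS1.
Qed.
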